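(* Let $G=\langle s_1,\ldots,s_r\rangle$ be a free group or free semigroup of rank $r\ge 1$, and let $T=(T_g)_{g\in G}$ be a measure-preserving action of $G$ on a standard probability space $(X,\mu)$. Let $\omega:G\to G$ be an automorphism, and let $T^\omega=(T^\omega_g)_{g\in G}$ be the action $T^\omega_gx:=T_{\omega(g)}x$. Then for any finite observable $\phi:X\to A$, $$f(T,\phi)=f(T^\omega,\phi).$$
   Context: Semigroups have an identity element $e$ (so a free semigroup of rank $r$ is the free monoid on $s_1,\dots,s_r$), and actions respect the identity. A measure-preserving action $T=(T_g)_{g\in G}$ of $G$ on $(X,\mu)$ consists of measure-preserving maps $T_g:X\to X$ with $T_{g_1}T_{g_2}=T_{g_1g_2}$. A finite observable is a measurable map $\phi:X\to A$ with $A$ a finite set. For a countable measurable partition $\alpha$ of $X$, $H(\alpha)=-\sum_{P\in\alpha}\mu(P)\log\mu(P)$ (with $0\log 0=0$), and $\alpha\vee\beta=\{P\cap Q: P\in\alpha,Q\in\beta\}$. Let $B(e,n)$ be the ball of radius $n$ around $e$ in $G$ for the word metric of the generating set ($\{s_1^{\pm1},\ldots,s_r^{\pm1}\}$ if $G$ is a group, $\{s_1,\ldots,s_r\}$ if $G$ is a semigroup). For a measure-preserving action $T$ of $G$ define $$F(T,\alpha)=(1-2r)H(\alpha)+\sum_{i=1}^rH(\alpha\vee T_{s_i}^{-1}\alpha),\qquad \alpha^n=\bigvee_{g\in B(e,n)}T_g^{-1}\alpha,\qquad f(T,\alpha)=\inf_nF(T,\alpha^n)$$ (and likewise for $T^\omega$,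 with the same fixed generators $s_1,\dots,s_r$). For an observable $\phi:X\to A$, $f(T,\phi):=f(T,\bar\phi)$ where $\bar\phi=\{\phi^{-1}(a)\}_{a\in A}$. *)

(* Defs.v *)
From HB Require Import structures.
From mathcomp Require Import all_boot all_order all_algebra.
From mathcomp Require Import all_classical all_reals all_analysis.
Set Implicit Arguments.
Unset Strict Implicit.
Unset Printing Implicit Defensive.
Import Order.TTheory GRing.Theory Num.Theory.
Local Open Scope classical_set_scope.
Local Open Scope ring_scope.

Section FreeGenerators.

(* Freeness is the universal property of the family s; H ranges over all
   groups (resp. all monoids) of the library. *)
Definition free_group (G : groupType) (r : nat) (s : 'I_r -> G) : Prop :=
  forall (H : groupType) (f : 'I_r -> H),
    exists2 h : {multiplicative G -> H}, (forall i, h (s i) = f i) &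
      forall h' : {multiplicative G -> H}, (forall i, h' (s i) = f i) -> h' =1 h.

(* Semigroups have an identity element and morphisms preserve it. *)
Definition free_semigroup (G : monoidType) (r : nat) (s : 'I_r -> G) : Prop :=
  forall (H : monoidType) (f : 'I_r -> H),
    exists2 h : UMagmaMorphism.type G H, (forall i, h (s i) = f i) &
      forall h' : UMagmaMorphism.type G H,
        (forall i, h' (s i) = f i) -> h' =1 h.

Definition group_generators (G : groupType) (r : nat) (s : 'I_r -> G) : set G :=
  [set g | exists i, g = s i \/ g = (s i)^-1%g].

Definition semigroup_generators (G : monoidType) (r : nat) (s : 'I_r -> G) :
    set G :=
  range s.

(* A word of length at most n is exactly an element at word distance at most n
   from the identity. *)
Definition word_ball (G : monoidType) (S : set G) (n : nat) : set G :=
  [set g | exists w : seq G,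
     [/\ (size w <= n)%N, (forall x, x \in w -> S x)
       & g = (\prod_(x <- w) x)%g]].

End FreeGenerators.

Section StandardSpaces.

Definition polish (R : realType) (Y : metricType R) : Prop :=
  (forall F : set_system Y, ProperFilter F -> cauchy F ->
     exists y : Y, F --> y) /\
  (exists2 D : set Y, countable D & dense D).

(* <<s open >> is the Borel sigma-algebra of Y. *)
Definition standard_borel (R : realType) d (X : measurableType d) : Prop :=
  exists (Y : metricType R) (f : X -> Y),
    [/\ polish Y, bijective f
      & forall A : set X, measurable A <-> <<s @open Y >> (f @` A)].

End StandardSpaces.

Section Actions.
Context (R : realType) (d : measure_display) (X : measurableType d).
Context (mu : probability X R).

Definition measure_preserving_action (G : monoidType) (T : G -> X -> X) : Prop :=
  [/\ T 1%g = id,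
      forall g h, T (g * h)%g = T g \o T h,
      forall g, measurable_fun setT (T g)
    & forall g (A : set X), measurable A -> mu (T g @^-1` A) = mu A].

Definition twisted_action (G : monoidType) (omega : G -> G) (T : G -> X -> X) :
    G -> X -> X :=
  fun g x => T (omega g) x.

(* Observables take values in a finite set with its discrete sigma-algebra. *)
Definition observable (A : finType) (phi : X -> A) : Prop :=
  forall B : set A, measurable (phi @^-1` B).

End Actions.

Section FInvariant.
Context (R : realType) (d : measure_display) (X : measurableType d).
Context (mu : probability X R).
Implicit Types alpha beta : set (set X).

(* A partition is the set of its cells.  Empty cells are harmless, since
   0 * ln 0 = 0. *)
Definition observable_partition (A : finType) (phi : X -> A) : set (set X) :=
  [set phi @^-1` [set a] | a in [set: A]].

Definition partition_entropy alpha : \bar R :=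
  (\esum_(P in alpha) (- (fine (mu P) * ln (fine (mu P))))%:E)%E.

Definition partition_join alpha beta : set (set X) :=
  [set P `&` Q | P in alpha & Q in beta].

(* The cells of the join of a family are obtained by choosing one cell of each
   member of the family and intersecting them. *)
Definition partition_bigjoin (I : Type) (B : set I) (beta : I -> set (set X)) :
    set (set X) :=
  [set P | exists2 Q : I -> set X, (forall i, B i -> beta i (Q i))
                                 & P = \bigcap_(i in B) Q i].

Definition partition_preimage (t : X -> X) alpha : set (set X) :=
  [set t @^-1` P | P in alpha].

Section Action.
Context (G : monoidType) (r : nat) (s : 'I_r -> G) (S : set G).

Definition F_functional (T : G -> X -> X) alpha : \bar R :=
  ((1 - 2 * r%:R)%:E * partition_entropy alpha +
   \sum_(i < r) partition_entropy
     (partition_join alpha (partition_preimage (T (s i)) alpha)))%E.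

Definition ball_partition (T : G -> X -> X) alpha (n : nat) : set (set X) :=
  partition_bigjoin (word_ball S n) (fun g => partition_preimage (T g) alpha).

(* S is the generating set defining the word metric.  The value can be -oo. *)
Definition f_invariant (T : G -> X -> X) alpha : \bar R :=
  ereal_inf [set F_functional T (ball_partition T alpha n) | n in [set: nat]].

Definition f_observable (T : G -> X -> X) (A : finType) (phi : X -> A) : \bar R :=
  f_invariant T (observable_partition phi).

End Action.

End FInvariant.

(* Main.v *)
Require Import Defs.
From HB Require Import structures.
From mathcomp Require Import all_boot all_order all_algebra.
From mathcomp Require Import perm.
From mathcomp Require Import all_classical all_reals all_analysis.
From mathcomp Require Import lra.

(** The free semigroup case is elementary: every element has a unique
    spelling as a word, an automorphism cannot shorten words, so it permutes the
    generators; hence it preserves the balls and permutes the sum in [F].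

    For a free group, write [H W] for the entropy of the join of the translates
    of the partition over a finite list [W] of group elements.  Then [H] is
    monotone, submodular, and invariant under right translation, and nothing
    else about the action matters.  With the mutual information
    I(A;B) = H(A) + H(B) - H(A,B), the functional [F] of a basis [t] on the join
    over [W] becomes H(W) - sum_i I(W t_i; W) ([rose_weight],
    [F_functional_rose]).  Since [twisted_action omega T] replaces the basis [s]
    by the basis [t] = [omega \o s] and balls by their images, it is enough to
    find, for a finite set [W], a ball of [s] whose weight with respect to [s]
    is at most the weight of [W] with respect to [t]; the other inequality is
    the same statement for the inverse automorphism.

    The passage from [t] to [s] is Stallings folding.  To a finite graph with
    edges labelled by the basis [s] and vertices labelled by finite subsets of
    the group attach the sum of the entropies of the vertices minus the sum of
    the mutual informations along the edges ([weight]).  Spelling each [t_j] as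
    a path of [s]-edges turns the rose of [t] into a graph of the same weight
    ([weight_segments]).  Identifying two edges that leave one vertex with the
    same label, and joining the labels of their ends, does not increase the
    weight, by submodularity ([fold_weight]).  When no fold is left, freeness
    forces a loop for each generator at the base vertex ([folded_loops]), and
    the count of vertices and edges, which is that of a rose with [r] petals,
    leaves only the edges of a spanning tree besides; each of these costs at
    most the entropy of one vertex, and discarding them leaves the rose of [s]
    with a larger label ([fold_to_rose]).  The same count ([card_marked]) shows
    that no fold ever identifies two edges with both ends in common, a move
    that would spoil the inequality.

    Finally, enlarging a label by [g * x], for [g] already present and [x] a
    generator or its inverse, does not increase the weight of the rose of [s]
    ([rose_weight_grow]), so a finite label can be grown into a ball
    ([grows_to_ball]). *)

Set Implicit Arguments.
Unset Strict Implicit.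
Unset Printing Implicit Defensive.
Import Order.TTheory.

(** * Free semigroups *)

(** A copy of the type of sequences, so that concatenation can be declared as
    its multiplication. *)
Definition word_monoid (I : choiceType) := seq I.
HB.instance Definition _ (I : choiceType) := Choice.on (word_monoid I).
HB.instance Definition _ (I : choiceType) :=
  isMonoid.Build (word_monoid I) (@catA I) (@cat0s I) (@cats0 I).

Section WordProduct.
Context (G : monoidType) (r : nat) (s : 'I_r -> G).

Definition word_product (w : word_monoid 'I_r) : G := (\prod_(i <- w) s i)%g.

Lemma word_product_is_monoid_morphism : monoid_morphism word_product.
Proof.
by split=> [|u v]; rewrite /word_product ?big_nil// [(u * v)%g]/(u ++ v) big_cat.
Qed.
HB.instance Definition _ := isUMagmaMorphism.Build _ _ word_product
  word_product_is_monoid_morphism.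

(** Both the identity and the composition of [h] with [word_product] extend
    [s], so the uniqueness part of freeness identifies them. *)
Lemma free_semigroup_spelling : free_semigroup s ->
  exists h : UMagmaMorphism.type G (word_monoid 'I_r),
    (forall i, h (s i) = [:: i]) /\ (forall g, word_product (h g) = g).
Proof.
move=> sfree; have [h hs _] := sfree (word_monoid 'I_r) (fun i => [:: i]).
exists h; split=> // g; have [k _ kuniq] := sfree G s.
rewrite -[RHS]/(idfun g) (kuniq idfun) // -(kuniq (word_product \o h)) // => i /=.
by rewrite hs /word_product big_seq1.
Qed.

End WordProduct.

Section FreeSemigroupAutomorphism.
Context (G : monoidType) (r : nat) (s : 'I_r -> G).
Hypothesis sfree : free_semigroup s.

(** An injective endomorphism sends no generator to the identity, hence cannot
    shorten words; applied to an automorphism and to its inverse, this makes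
    the image of a generator a word of length one. *)
Lemma free_semigroup_automorphism_perm (omega : UMagmaMorphism.type G G) :
  bijective omega -> exists sigma : {perm 'I_r}, forall i, omega (s i) = s (sigma i).
Proof.
move=> obij; have [h [hs hK]] := free_semigroup_spelling sfree.
have s_inj : injective s by move=> i j /(congr1 h); rewrite !hs => -[].
have size1 g : size (h g) = 0 -> g = 1%g.
  by move=> /size0nil h0; rewrite -[g]hK h0 /word_product big_nil.
have leq_morph (k : UMagmaMorphism.type G G) : injective k ->
    forall g, (size (h g) <= size (h (k g)))%N.
  move=> kinj g; rewrite -{2}[g]hK /word_product gmulf_prod gmulf_prod.
  elim: (h g) => [|i w IH]; first by rewrite big_nil.
  rewrite big_cons [(_ * _)%g in X in (_ <= X)%N]/(_ ++ _) size_cat /= -add1n leq_add//.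
  rewrite lt0n; apply/eqP => /size1/eqP; rewrite gmulf_eq1// => /eqP /(congr1 h).
  by rewrite hs gmulf1.
have oinj : injective omega by exact: bij_inj.
have gen g : size (h g) = 1 -> exists i, g = s i.
  case hg: (h g) => [|i []]// _; exists i.
  by rewrite -[g]hK hg /word_product big_seq1.
have [omega' oK o'K] := obij.
pose f : UMagmaMorphism.type G G := HB.pack omega'
  (isUMagmaMorphism.Build _ _ omega' (can2_gmulf1 oK o'K, can2_gmulfM oK o'K)).
have og i : exists j, omega (s i) = s j.
  apply: gen; apply/eqP; rewrite eqn_leq -{2}[1](_ : size (h (s i)) = 1) ?leq_morph ?hs//.
  rewrite andbT (leq_trans (leq_morph f _ _))//; first exact: (can_inj o'K).
  by rewrite /= oK hs.
have [sg sgE] := choice og.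
have sg_inj : injective sg.
  by move=> i j ij; apply/s_inj/oinj; rewrite !sgE ij.
by exists (perm sg_inj) => i; rewrite permE.
Qed.

Lemma word_ball_automorphism (omega : UMagmaMorphism.type G G) n g :
  bijective omega ->
  word_ball (semigroup_generators s) n (omega g) <->
  word_ball (semigroup_generators s) n g.
Proof.
move=> obij; have [sigma sE] := free_semigroup_automorphism_perm obij.
have [omega' oK o'K] := obij.
split=> -[w [wn wS wE]].
  exists (map omega' w); split; first by rewrite size_map.
    move=> x /mapP[y /wS[i _ <-] ->]; exists (sigma^-1%g i) => //.
    by apply: (bij_inj obij); rewrite sE permKV o'K.
  apply: (bij_inj obij); rewrite wE gmulf_prod big_map.
  by apply: eq_bigr => x _; rewrite o'K.
exists (map omega w); split; first by rewrite size_map.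
  by move=> x /mapP[y /wS[i _ <-] ->]; exists (sigma i).
by rewrite wE gmulf_prod big_map.
Qed.

End FreeSemigroupAutomorphism.

Section SemigroupInvariant.
Local Open Scope classical_set_scope.

(** Applied to the automorphism itself: the ball partitions of the action and
    of the twisted action are the same set of cells. *)
Lemma partition_bigjoin_reindex (d : measure_display) (X : measurableType d)
    (I : Type) (B : set I)
    (beta : I -> set (set X)) (k : I -> I) :
  bijective k -> (forall i, B (k i) <-> B i) ->
  partition_bigjoin B (beta \o k) = partition_bigjoin B beta.
Proof.
move=> [k' kK k'K] Bk; apply/seteqP; split=> P [Q QB PE].
  exists (Q \o k') => [i Bi /=|]; first by rewrite -{1}[i]k'K; apply/QB/Bk; rewrite k'K.
  rewrite PE; apply/seteqP; split=> x Px i Bi /=.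
    by apply: Px; apply/Bk; rewrite k'K.
  by rewrite -[i]kK; apply: Px; apply/Bk.
exists (Q \o k) => [i Bi /=|]; first by apply/QB/Bk.
rewrite PE; apply/seteqP; split=> x Px i Bi /=; first by apply: Px; apply/Bk.
by rewrite -[i]k'K; apply: Px; apply/Bk; rewrite k'K.
Qed.

Lemma f_observable_free_semigroup (R : realType) (d : measure_display)
    (X : measurableType d) (mu : probability X R) (r : nat) (A : finType)
    (phi : X -> A) (G : monoidType) (s : 'I_r -> G) (T : G -> X -> X)
    (omega : UMagmaMorphism.type G G) :
  free_semigroup s -> bijective omega ->
  f_observable mu s (semigroup_generators s) T phi =
  f_observable mu s (semigroup_generators s) (twisted_action omega T) phi.
Proof.
move=> sfree obij; have [sigma sE] := free_semigroup_automorphism_perm sfree obij.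
congr ereal_inf; apply: eq_imagel => n _.
have -> : ball_partition (semigroup_generators s) (twisted_action omega T)
    (observable_partition phi) n =
  ball_partition (semigroup_generators s) T (observable_partition phi) n.
  apply: partition_bigjoin_reindex => // g.
  exact: word_ball_automorphism.
congr (_ + _)%E; rewrite (reindex_inj (@perm_inj _ sigma)).
by apply: eq_bigr => i _; rewrite /twisted_action sE.
Qed.

End SemigroupInvariant.

(** * Graphs labelled by generators and Stallings folding *)

Section LabelledGraphs.
Context (G : groupType) (r : nat) (s : 'I_r -> G) (V : finType).

Definition edge : finType := (V * 'I_r * V)%type.
Implicit Types (E : {set edge}) (vs : {set V}) (root : V) (e : edge).

(** The length is recorded to speak of shortest walks. *)
Inductive walk E root : nat -> G -> V -> Prop :=
| walk_nil : walk E root 0 1%g root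
| walk_fwd n g u i v : walk E root n g u -> (u, i, v) \in E ->
    walk E root n.+1 (g * s i)%g v
| walk_bwd n g u i v : walk E root n g u -> (v, i, u) \in E ->
    walk E root n.+1 (g * (s i)^-1)%g v.

(** A connected graph whose fundamental group at [root], read through [s],
    contains the generators.  The vertices
    live in an ambient finite type and [vs] holds those in use, so that a fold
    stays in the same type. *)
Record marked E vs root : Prop := Marked {
  marked_root : root \in vs;
  marked_edge : forall e, e \in E -> e.1.1 \in vs /\ e.2 \in vs;
  marked_conn : forall v, v \in vs -> exists n g, walk E root n g v;
  marked_loop : forall i, exists n, walk E root n (s i) root }.

Definition edge_map (pi : V -> V) e : edge := (pi e.1.1, e.1.2, pi e.2).

Lemma walk_map (pi : V -> V) E root n g v : walk E root n g v ->
  walk (edge_map pi @: E) (pi root) n g (pi v).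
Proof.
elim=> [|{}n {}g u i {}v _ IH uv|{}n {}g u i {}v _ IH uv]; first exact: walk_nil.
- by apply: walk_fwd IH _; apply/imsetP; exists (u, i, v).
- by apply: walk_bwd IH _; apply/imsetP; exists (v, i, u).
Qed.

Lemma marked_map (pi : V -> V) E vs root : marked E vs root ->
  marked (edge_map pi @: E) (pi @: vs) (pi root).
Proof.
move=> [rvs Evs conn loop]; split; first exact: imset_f.
- by move=> _ /imsetP[e /Evs[e1 e2] ->]; split; apply: imset_f.
- move=> _ /imsetP[v /conn[n [g w]] ->]; exists n, g; exact: walk_map.
- by move=> i; have [n w] := loop i; exists n; apply: walk_map.
Qed.

(** Each generator acts on the vertices as a partial injection. *)
Definition folded E := forall u i v w,
  ((u, i, v) \in E -> (u, i, w) \in E -> v = w) /\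
  ((v, i, u) \in E -> (w, i, u) \in E -> v = w).

Definition fold_pair E x y e1 e2 : Prop :=
  [/\ e1 \in E, e2 \in E & exists u i,
     (e1 = (u, i, x) /\ e2 = (u, i, y)) \/ (e1 = (x, i, u) /\ e2 = (y, i, u))].

(** The vertex [y], which the fold removes, can be chosen different from the
    base vertex by exchanging the two edges. *)
Lemma not_folded E root : ~ folded E ->
  exists x y e1 e2, [/\ x != y, y != root & fold_pair E x y e1 e2].
Proof.
move=> nf.
have [x [y [e1 [e2 [xy f]]]]] : exists x y e1 e2, x != y /\ fold_pair E x y e1 e2.
  apply: contrapT => nex; apply: nf => u i v w; split=> vE wE;
    apply: contrapT => /eqP vw; apply: nex; exists v, w.
  - by exists (u, i, v), (u, i, w); split=> //; split=> //; exists u, i; left.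
  - by exists (v, i, u), (w, i, u); split=> //; split=> //; exists u, i; right.
have [yr|yr] := eqVneq y root; last by exists x, y, e1, e2.
exists y, x, e2, e1; split; rewrite 1?eq_sym//; first by rewrite -yr eq_sym.
case: f => ? ? [u [i f]]; split=> //; exists u, i.
by case: f => -[-> ->]; [left|right].
Qed.

Section Dilation.
Context (E : {set edge}) (E_folded : folded E).

Definition out_nbr i u : option V := [pick v | (u, i, v) \in E].
Definition in_nbr i v : option V := [pick u | (u, i, v) \in E].

Lemma out_nbrE i u v : out_nbr i u = Some v <-> in_nbr i v = Some u.
Proof.
rewrite /out_nbr /in_nbr; split.
  case: pickP => // w uw [<-]; case: pickP => [u' u'w|/(_ u)]; last by rewrite uw.
  by congr Some; exact: (E_folded w i u' u).2.
case: pickP => // w uw [<-]; case: pickP => [u' u'w|/(_ v)]; last by rewrite uw.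
by congr Some; exact: (E_folded w i u' v).1.
Qed.

(** In a folded graph a generator is a partial injection of [V].  On two copies
    of [V] it extends to a permutation: it acts as itself on the first copy, as
    its inverse on the second, and changes copy where it is undefined.  Unlike an
    arbitrary extension, this one shows where the injection is undefined. *)
Definition dilation i (p : V * bool) : V * bool :=
  let: (v, b) := p in
  if (if b then in_nbr i v else out_nbr i v) is Some w then (w, b) else (v, ~~ b).

Lemma dilation_inj i : injective (dilation i).
Proof.
apply: (can_inj (g := fun p : V * bool => let: (v, b) := p in
  if (if b then out_nbr i v else in_nbr i v) is Some w then (w, b) else (v, ~~ b))).
move=> [v []] /=.
  case iv: (in_nbr i v) => [w|] /=; last by rewrite iv.
  by move/out_nbrE: iv => ->.
case ov: (out_nbr i v) => [w|] /=; last by rewrite ov.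
by move/out_nbrE: ov => ->.
Qed.

(** By freeness the dilations define an action of the group for which a walk
    moves the base vertex, in the first copy, to its end.  A closed walk reading
    [s i] shows that the dilation of [i] fixes the base vertex there, which
    happens only if the graph has the corresponding loop. *)
Lemma folded_loops vs root i : free_group s -> marked E vs root ->
  (root, i, root) \in E.
Proof.
move=> sfree Em; pose p j := perm (@dilation_inj j).
have [h hs _] := sfree {perm V * bool} p.
have h1 : h 1%g = 1%g by apply: (mulgI (h 1%g)); rewrite -gmulfM !mulg1.
have pE u j v : (u, j, v) \in E -> p j (u, false) = (v, false).
  move=> uv; rewrite permE /= /out_nbr; case: pickP => [w uw|/(_ v)]; last by rewrite uv.
  by congr (_, _); exact: (E_folded u j w v).1.
have hwalk n g v : walk E root n g v -> h g (root, false) = (v, false).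
  elim=> [|{}n {}g u j {}v _ IH uv|{}n {}g u j {}v _ IH uv]; first by rewrite h1 perm1.
  - by rewrite gmulfM permM hs IH; apply: pE.
  - apply: (@perm_inj _ (p j)); rewrite (pE _ _ _ uv) -IH -hs -permM -gmulfM.
    by rewrite mulgVK.
have [n /hwalk] := marked_loop Em i.
rewrite hs permE /= /out_nbr; case: pickP => [w uw [wE]|_ []//].
by rewrite wE in uw.
Qed.

End Dilation.

(** Each vertex other than the base vertex is sent to the last edge of a
    shortest walk reaching it.  Two vertices with the same edge would each be
    strictly closer to the base vertex than the other. *)
Lemma spanning_tree (i0 : 'I_r) E vs root : marked E vs root ->
  exists par : V -> edge,
    [/\ {in vs :\ root &, injective par}
      & forall v, v \in vs :\ root ->
         [/\ par v \in E, v = (par v).1.1 \/ v = (par v).2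
           & forall i, par v <> (root, i, root)]].
Proof.
move=> [rvs Evs conn _].
have /choice[d dP] : forall v, exists n, v \in vs ->
    (exists g, walk E root n g v) /\ (forall m g, walk E root m g v -> (n <= m)%N).
  move=> v; have [vvs|] := boolP (v \in vs); last by exists 0.
  have ex : exists n, `[< exists g, walk E root n g v >].
    by have [n [g w]] := conn v vvs; exists n; apply/asboolP; exists g.
  have /asboolP w := ex_minnP ex; case: (ex_minnP ex) => n /asboolP wn nmin.
  exists n => _; split=> // m g wm; apply: nmin; apply/asboolP; by exists g.
have /choice[par parP] : forall v, exists e, v \in vs :\ root ->
    exists u i, [/\ e \in E, (d u < d v)%N & e = (u, i, v) \/ e = (v, i, u)].
  move=> v; have [|] := boolP (v \in vs :\ root); last first.
    by exists (v, i0, v).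
  rewrite !inE => /andP[vr vvs]; have [[g w] _] := dP v vvs.
  case Ed: (d v) w => [|n] w; inversion w; subst.
  - by rewrite eqxx in vr.
  - exists (u, i, v) => _; exists u, i; split=> //; last by left.
    have [uvs _] := Evs _ H1; by rewrite ltnS; apply: (dP u uvs).2 H0.
  - exists (v, i, u) => _; exists u, i; split=> //; last by right.
    have [_ uvs] := Evs _ H1; by rewrite ltnS; apply: (dP u uvs).2 H0.
exists par; split.
  move=> v w /parP[u [i [_ uv pv]]] /parP[u' [i' [_ uw pw]]] vw.
  have : v = w \/ u = w /\ v = u'.
    by move: pv pw; rewrite vw => -[->|->] [[]|[]]; intuition congruence.
  by case=> // -[uE vE]; move: uv uw; rewrite uE -vE => /ltnW; rewrite leqNgt => /negP.
move=> v vvs; have [u [i [pE uv pv]]] := parP v vvs; split=> //.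
  by case: pv => ->; [right|left].
move: vvs; rewrite !inE => /andP[/eqP vr _] j pr.
by apply: vr; case: pv; rewrite pr => -[].
Qed.

End LabelledGraphs.

(** * The weight of a labelled graph *)

Section Weights.
Import GRing.Theory Num.Theory.
Local Open Scope ring_scope.

Context (G : groupType) (R : realFieldType) (H : seq G -> R).

Definition translate (A : seq G) (g : G) : seq G := [seq (a * g)%g | a <- A].

(** What the argument uses of the entropy of the join of the translates of a
    partition over a list of group elements.  Monotonicity on lists compared by
    membership makes order and repetitions irrelevant. *)
Record translation_entropy : Prop := TranslationEntropy {
  tent_mono : forall A B, {subset A <= B} -> H A <= H B;
  tent_submodular : forall A B C, H (A ++ B ++ C) + H C <= H (A ++ C) + H (B ++ C);
  tent_translate : forall A g, H (translate A g) = H A }.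

Definition mutual (A B : seq G) : R := H A + H B - H (A ++ B).

(** The functional F of the join over [W], for the basis [t]: by translation
    invariance of [H] it equals
    (1 - 2 r) H(W) + sum_i H(W t_i, W). *)
Definition rose_weight (I : finType) (t : I -> G) (W : seq G) : R :=
  H W - \sum_i mutual (translate W (t i)) W.

Hypothesis Hent : translation_entropy.

Lemma translateM A g h : translate (translate A g) h = translate A (g * h)%g.
Proof. by rewrite /translate -map_comp; apply: eq_map => a /=; rewrite mulgA. Qed.

Lemma translate_sub A A' g :
  {subset A <= A'} -> {subset translate A g <= translate A' g}.
Proof. by move=> AA' _ /mapP[a aA ->]; apply/map_f/AA'. Qed.

Lemma tent_eq A B : A =i B -> H A = H B.
Proof.
by move=> AB; apply/le_anti/andP; split; apply: (tent_mono Hent) => g; rewrite AB.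
Qed.

Lemma mutualC A B : mutual A B = mutual B A.
Proof.
rewrite /mutual (tent_eq (_ : A ++ B =i B ++ A)); first by lra.
by move=> g; rewrite !mem_cat orbC.
Qed.

Lemma mutual_translate A B g : mutual (translate A g) (translate B g) = mutual A B.
Proof. by rewrite /mutual -map_cat !(tent_translate Hent). Qed.

(** Submodularity over the common part [A]: adding the elements of [A'] raises
    the entropy of [A] at least as much as that of [A] joined with [B]. *)
Lemma mutual_monol A A' B : {subset A <= A'} -> mutual A B <= mutual A' B.
Proof.
move=> AA'; have := tent_submodular Hent A' B A.
rewrite (tent_eq (_ : A' ++ B ++ A =i A' ++ B)); last first.
  move=> g; rewrite !mem_cat; have := AA' g; case: (g \in A) => // [->//|_]; rewrite ?orbF//.
rewrite (tent_eq (_ : A' ++ A =i A')); last first.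
  move=> g; rewrite !mem_cat; have := AA' g; case: (g \in A) => // [->//|_]; rewrite ?orbF//.
rewrite (tent_eq (_ : B ++ A =i A ++ B)); last by move=> g; rewrite !mem_cat orbC.
rewrite /mutual; lra.
Qed.

Lemma mutual_mono A A' B B' : {subset A <= A'} -> {subset B <= B'} ->
  mutual A B <= mutual A' B'.
Proof.
move=> AA' BB'; apply: le_trans (mutual_monol _ AA') _.
by rewrite mutualC (mutualC A') mutual_monol.
Qed.

Lemma mutual_ler A B : mutual A B <= H B.
Proof.
have : H A <= H (A ++ B) by apply: (tent_mono Hent) => g; rewrite mem_cat => ->.
rewrite /mutual; lra.
Qed.

Lemma mutual_lel A B : mutual A B <= H A.
Proof. by rewrite mutualC mutual_ler. Qed.

(** In terms of conditional entropies this says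
    H(B,C|A) <= H(B|A) + H(C|A). *)
Lemma mutual_cat A B C :
  mutual A B + mutual A C + H (B ++ C) <= H B + H C + mutual A (B ++ C).
Proof.
have := tent_submodular Hent B C A.
rewrite (tent_eq (_ : B ++ C ++ A =i A ++ B ++ C)); last first.
  by move=> g; rewrite !mem_cat orbA orbC.
rewrite (tent_eq (_ : B ++ A =i A ++ B)); last by move=> g; rewrite !mem_cat orbC.
rewrite (tent_eq (_ : C ++ A =i A ++ C)); last by move=> g; rewrite !mem_cat orbC.
rewrite /mutual; lra.
Qed.

Section Graph.
Context (r : nat) (s : 'I_r -> G) (V : finType).
Implicit Types (E : {set edge r V}) (vs : {set V}) (W : V -> seq G).

(** Crossing an edge labelled [s i] multiplies positions on the right by [s i],
    so the label of the origin is translated before it is compared with the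
    label of the end. *)
Definition edge_mutual W (e : edge r V) : R :=
  mutual (translate (W e.1.1) (s e.1.2)) (W e.2).

Definition weight E vs W : R := \sum_(v in vs) H (W v) - \sum_(e in E) edge_mutual W e.

Definition fold_map (x y v : V) : V := if v == y then x else v.
Definition fold_label W (x y v : V) : seq G := if v == x then W x ++ W y else W v.

Lemma sub_fold_label W x y v : x != y ->
  {subset W v <= fold_label W x y (fold_map x y v)}.
Proof.
move=> xy g gv; rewrite /fold_label /fold_map.
have [vy|vy] := eqVneq v y; first by rewrite eqxx mem_cat -vy gv orbT.
by case: eqVneq => [<-|//]; rewrite mem_cat gv.
Qed.

Lemma fold_map_imset x y vs : x != y -> x \in vs -> fold_map x y @: vs = vs :\ y.
Proof.
move=> xy xvs; apply/setP => v; rewrite !inE; apply/imsetP/andP => [[w wvs ->]|[vy vvs]].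
  by rewrite /fold_map; case: (eqVneq w y) => [_|//]; split.
by exists v => //; rewrite /fold_map (negPf vy).
Qed.

Lemma fold_pair_neq E x y e1 e2 : x != y -> fold_pair E x y e1 e2 -> e1 != e2.
Proof.
move=> xy [_ _ [u [i ue]]]; apply: contraNneq xy.
by case: ue => -[-> ->] [->].
Qed.

Lemma fold_pair_map E x y e1 e2 : fold_pair E x y e1 e2 ->
  edge_map (fold_map x y) e1 = edge_map (fold_map x y) e2.
Proof.
move=> [_ _ [u [i ue]]]; rewrite /edge_map /fold_map.
by case: ue => -[-> ->] /=; rewrite eqxx; case: (eqVneq x y).
Qed.

Lemma fold_imset E x y e1 e2 : x != y -> fold_pair E x y e1 e2 ->
  edge_map (fold_map x y) @: E = edge_map (fold_map x y) @: (E :\ e2).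
Proof.
move=> xy f; apply/eqP; rewrite finset.eqEsubset [X in _ && X]imsetS ?finset.subD1set// andbT.
have [e1E _ _] := f.
apply/fintype.subsetP => _ /imsetP[e eE ->].
have [->|ne] := eqVneq e e2; last by apply: imset_f; rewrite !inE ne.
by rewrite -(fold_pair_map f); apply: imset_f; rewrite !inE (fold_pair_neq xy f).
Qed.

(** The gain and the loss of a fold: the entropies of [x] and [y] and the
    mutual informations of the two edges are replaced by those of the merged
    vertex and of the merged edge. *)
Lemma fold_edge_mutual E W x y e1 e2 : x != y -> fold_pair E x y e1 e2 ->
  edge_mutual W e1 + edge_mutual W e2 + H (W x ++ W y) <=
  H (W x) + H (W y) +
    edge_mutual (fold_label W x y) (edge_map (fold_map x y) e1).
Proof.
move=> xy [_ _ [u [i [] [-> ->]]]]; rewrite /edge_mutual /edge_map /=.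
  apply: le_trans (mutual_cat _ _ _) _; rewrite lerD2l.
  have -> : fold_label W x y (fold_map x y x) = W x ++ W y.
    by rewrite /fold_map (negPf xy) /fold_label eqxx.
  by apply/mutual_monol/translate_sub => g; apply: sub_fold_label.
have -> : fold_label W x y (fold_map x y x) = W x ++ W y.
  by rewrite /fold_map (negPf xy) /fold_label eqxx.
have -> : translate (W x ++ W y) (s i) = translate (W x) (s i) ++ translate (W y) (s i).
  exact: map_cat.
have := mutual_cat (W u) (translate (W x) (s i)) (translate (W y) (s i)).
rewrite -map_cat !(tent_translate Hent) map_cat !(mutualC (W u)) => /le_trans; apply.
rewrite lerD2l; apply: mutual_mono => //; exact: sub_fold_label.
Qed.

(** The edges other than the two that are folded only see their labels grow, so
    their mutual informations grow.  The injectivity hypothesis says that no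
    further edges collapse; without it some mutual information would be lost. *)
Lemma fold_weight E vs W x y e1 e2 : x != y -> x \in vs -> y \in vs ->
  fold_pair E x y e1 e2 ->
  {in E :\ e2 &, injective (edge_map (fold_map x y))} ->
  weight (edge_map (fold_map x y) @: E) (fold_map x y @: vs) (fold_label W x y)
    <= weight E vs W.
Proof.
move=> xy xvs yvs f finj; have [e1E e2E _] := f.
have e12 := fold_pair_neq xy f.
rewrite /weight (fold_imset xy f) fold_map_imset// big_imset//=.
rewrite (big_setD1 y yvs) [in leRHS](big_setD1 x) ?inE ?xy//=.
rewrite [in leLHS](big_setD1 x) ?inE ?xy//=.
rewrite (big_setD1 e2 e2E) [in leRHS](big_setD1 e1) ?inE ?e12//=.
rewrite [in leLHS](big_setD1 e1) ?inE ?e12//=.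
have -> : \sum_(v in vs :\ y :\ x) H (fold_label W x y v) =
          \sum_(v in vs :\ y :\ x) H (W v).
  by apply: eq_bigr => v; rewrite !inE /fold_label => /andP[/negPf -> _].
have := fold_edge_mutual W xy f.
have : \sum_(e in E :\ e2 :\ e1) edge_mutual W e <=
       \sum_(e in E :\ e2 :\ e1)
         edge_mutual (fold_label W x y) (edge_map (fold_map x y) e).
  apply: ler_sum => e _; apply: mutual_mono => [|g]; last exact: sub_fold_label.
  by apply: translate_sub => g; apply: sub_fold_label.
rewrite {3}/fold_label eqxx; lra.
Qed.

Context (i0 : 'I_r) (sfree : free_group s).

Definition petal (root : V) (i : 'I_r) : edge r V := (root, i, root).

Lemma folded_split E vs root : folded E -> marked s E vs root ->
  exists par : V -> edge r V,
    [/\ {in vs :\ root &, injective par},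
        forall v, v \in vs :\ root -> v = (par v).1.1 \/ v = (par v).2,
        [disjoint petal root @: 'I_r & par @: (vs :\ root)]
      & petal root @: 'I_r :|: par @: (vs :\ root) \subset E].
Proof.
move=> Ef Em; have [par [pinj parP]] := spanning_tree i0 Em.
exists par; split=> //.
- by move=> v /parP[].
- rewrite -finset.setI_eq0 -finset.subset0; apply/fintype.subsetP => e; rewrite !inE => /andP[].
  move=> /imsetP[i _ ->] /imsetP[v /parP[_ _ pv] e'].
  by case: (pv i); rewrite -e'.
- rewrite finset.subUset; apply/andP; split; apply/fintype.subsetP => e /imsetP[v vvs ->].
    exact: (folded_loops Ef _ sfree Em).
  by have [] := parP v vvs.
Qed.

Lemma petal_inj root : injective (petal root).
Proof. by move=> i j []. Qed.

(** The Euler characteristic of a connected graph whose fundamental group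
    surjects onto a free group of rank [r] is at most 1 - r.  A fold removes one
    vertex and at least one edge, which reduces the inequality to folded graphs,
    where the petals and the spanning tree are disjoint sets of edges. *)
Lemma card_marked E vs root : marked s E vs root -> (r + #|vs| <= #|E|.+1)%N.
Proof.
have [n] := ubnP #|vs|; elim: n => // n IH in E vs *; rewrite ltnS => vsn Em.
have rvs := marked_root Em.
have [Ef|/not_folded-/(_ root)[x [y [e1 [e2 [xy yr f]]]]]] := pselect (folded E).
  have [par [pinj _ dis sub]] := folded_split Ef Em.
  have := subset_leq_card sub; rewrite cardsU disjoint_setI0// cards0 subn0.
  rewrite (card_imset _ (@petal_inj root)) card_ord card_in_imset//.
  by rewrite (cardsD1 root vs) rvs add1n addnS ltnS.
have [e1E e2E ue] := f.
have [xvs yvs] : x \in vs /\ y \in vs.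
  have := marked_edge Em e1E; have := marked_edge Em e2E.
  by case: ue => u [i [] [-> ->]] /= [? ?] [? ?].
have := marked_map (fold_map x y) Em.
rewrite fold_map_imset// [fold_map x y root]ifN 1?eq_sym// => /IH.
have := cardsD1 y vs; rewrite yvs add1n => vsE; rewrite vsE in vsn *.
move=> /(_ vsn) /leq_trans le1; rewrite addnS ltnS; apply: le1.
rewrite (fold_imset xy f) (cardsD1 e2 E) e2E add1n ltnS.
exact: leq_imset_card.
Qed.

(** With as few edges as the rank permits, [card_marked] applied after a fold
    shows that exactly one edge has disappeared, which is the injectivity that
    [fold_weight] needs; and in a folded graph there are no edges besides the
    petals and the spanning tree.  The mutual information along a tree edge is at
    most the entropy of the vertex it is attached to, so the tree can be
    discarded together with those vertices. *)
Lemma fold_to_rose E vs root W : marked s E vs root -> (#|E| < r + #|vs|)%N ->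
  exists2 W', {subset W root <= W'} & rose_weight s W' <= weight E vs W.
Proof.
have [n] := ubnP #|vs|; elim: n => // n IH in E vs W *; rewrite ltnS => vsn Em EV.
have rvs := marked_root Em.
have [Ef|/not_folded-/(_ root)[x [y [e1 [e2 [xy yr f]]]]]] := pselect (folded E).
  have [par [pinj parP dis sub]] := folded_split Ef Em.
  exists (W root) => //.
  (* E has at most r + |vs| - 1 elements, the cardinal of the union. *)
  have /eqP EE : petal root @: 'I_r :|: par @: (vs :\ root) == E.
    rewrite eqEcard sub cardsU disjoint_setI0// cards0 subn0.
    rewrite (card_imset _ (@petal_inj root)) card_ord card_in_imset//.
    by move: EV; rewrite (cardsD1 root vs) rvs add1n addnS ltnS.
  rewrite /weight -EE (eq_bigl _ _ (fun e => finset.in_setU e _ _)) bigU//=.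
  rewrite [in leRHS](big_setD1 root rvs)/= !big_imset//=; last first.
    by move=> i j _ _; apply: petal_inj.
  rewrite /rose_weight /edge_mutual /=.
  suff : \sum_(v in vs :\ root) mutual (translate (W (par v).1.1) (s (par v).1.2))
            (W (par v).2) <= \sum_(v in vs :\ root) H (W v).
    rewrite [X in _ - (X + _)](_ : _ = \sum_i mutual (translate (W root) (s i)) (W root)).
      lra.
    exact: eq_bigl.
  apply: ler_sum => v /parP[vE|vE]; last by rewrite -vE mutual_ler.
  by apply: le_trans (mutual_lel _ _) _; rewrite (tent_translate Hent) -vE.
have [e1E e2E ue] := f.
have [xvs yvs] : x \in vs /\ y \in vs.
  have := marked_edge Em e1E; have := marked_edge Em e2E.
  by case: ue => u [i [] [-> ->]] /= [? ?] [? ?].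
have Em' := marked_map (fold_map x y) Em.
have root' : fold_map x y root = root by rewrite /fold_map ifN 1?eq_sym.
rewrite root' in Em'.
have vsE : #|vs| = #|fold_map x y @: vs|.+1.
  by rewrite fold_map_imset// (cardsD1 y vs) yvs.
have EE := cardsD1 e2 E; rewrite e2E add1n in EE.
(* The image of E is the image of E without e2, and by card_marked it has at
   least |E| - 1 elements. *)
have finj : {in E :\ e2 &, injective (edge_map (fold_map x y))}.
  apply/imset_injP; rewrite eqn_leq leq_imset_card /= -(fold_imset xy f).
  rewrite -ltnS -EE; apply: leq_trans (card_marked Em').
  by rewrite -ltnS -addnS -vsE.
have [||W' W'r W'w] := IH _ _ (fold_label W x y) _ Em'.
- by rewrite -vsE.
- rewrite (fold_imset xy f) (card_in_imset finj).
  by move: EV; rewrite EE vsE addnS ltnS.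
exists W' => [g gr|]; last exact: le_trans W'w (fold_weight W xy xvs yvs f finj).
by apply: W'r; rewrite -[X in fold_label _ _ _ X]root'; apply: sub_fold_label.
Qed.

End Graph.
End Weights.

(** * Words, balls, and growth along the right Cayley graph *)

Section Letters.
Context (G : groupType) (r : nat) (s : 'I_r -> G).

Definition letter (x : 'I_r * bool) : G := if x.2 then (s x.1)^-1%g else s x.1.

Definition spell (l : seq ('I_r * bool)) : G := (\prod_(x <- l) letter x)%g.

Lemma spell_nil : spell [::] = 1%g. Proof. by rewrite /spell big_nil. Qed.

Lemma spell_rcons l x : spell (rcons l x) = (spell l * letter x)%g.
Proof. by rewrite /spell -cats1 big_cat big_seq1. Qed.

Lemma spell_cat l l' : spell (l ++ l') = (spell l * spell l')%g.
Proof. by rewrite /spell big_cat. Qed.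

Lemma spellV l : exists l', spell l' = (spell l)^-1%g.
Proof.
elim/last_ind: l => [|l [i b] [l' IH]]; first by exists [::]; rewrite spell_nil invg1.
exists ((i, ~~ b) :: l'); rewrite -cat1s spell_cat spell_rcons IH invgM.
by rewrite {1}/spell big_seq1 /letter; case: b; rewrite /= ?invgK.
Qed.

Definition spelled : {pred G} := [pred g | `[< exists l, spell l = g >]].

Lemma spelledP g : reflect (exists l, spell l = g) (g \in spelled).
Proof. exact: asboolP. Qed.

Lemma spelled_group_closed : group_closed spelled.
Proof.
split=> [|g h]; first by apply/spelledP; exists [::]; exact: spell_nil.
move=> /spelledP[l <-] /spelledP[l' <-]; apply/spelledP.
by have [l'' <-] := spellV l'; exists (l ++ l''); rewrite spell_cat.
Qed.

Definition spelled_group : Type := {g : G | spelled g}.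
HB.instance Definition _ := SubChoice.on spelled_group.
HB.instance Definition _ :=
  SubChoice_isSubGroup.Build G spelled spelled_group spelled_group_closed.

(** Composed with the inclusion, the morphism to the subgroup generated by [s]
    fixes [s], so it is the identity and its values lie in the subgroup. *)
Lemma free_group_spelling : free_group s -> forall g, exists l, spell l = g.
Proof.
move=> sfree g.
have sP i : spelled (s i).
  by apply/asboolP; exists [:: (i, false)]; rewrite /spell big_seq1.
have [h hs _] := sfree spelled_group (fun i => exist _ (s i) (sP i)).
have [k _ kuniq] := sfree G s.
suff <- : val (h g) = g by have /asboolP := valP (h g).
rewrite -[RHS]/(idfun g) (kuniq idfun)// -(kuniq (val \o h))// => i /=.
by rewrite hs.
Qed.

Local Notation ball := (word_ball (group_generators s)).

Lemma letter_generator x : group_generators s (letter x).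
Proof. by exists x.1; rewrite /letter; case: x.2; [right|left]. Qed.

Lemma generator_letter g : group_generators s g -> exists x, g = letter x.
Proof. by case=> i [->|->]; [exists (i, false)|exists (i, true)]. Qed.

Lemma word_ballP n g :
  ball n g <-> exists2 l, (size l <= n)%N & spell l = g.
Proof.
split=> [[w [wn wS ->]]|[l ln <-]].
  elim: w n wn wS => [|y w IH] n wn wS; first by exists [::]; rewrite ?spell_nil ?big_nil.
  case: n wn => // n wn; have [x xw|l ln lw] := IH n wn.
    by apply: wS; rewrite inE xw orbT.
  have [|x ->] := @generator_letter y; first by apply: wS; rewrite inE eqxx.
  by exists (x :: l) => //; rewrite -cat1s spell_cat big_cons lw {1}/spell big_seq1.
exists (map letter l); split; first by rewrite size_map.
  by move=> _ /mapP[x _ ->]; exact: letter_generator.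
by rewrite big_map.
Qed.

Lemma word_ball_enum n : exists L : seq G, forall g, g \in L <-> ball n g.
Proof.
elim: n => [|n [L LP]].
  exists [:: 1%g] => g; rewrite word_ballP inE; split=> [/eqP ->|[[]//]].
    by exists [::]; rewrite ?spell_nil.
  by rewrite spell_nil => _ ->.
exists (L ++ [seq (g * letter x)%g | g <- L, x <- enum {: 'I_r * bool}]) => g.
rewrite mem_cat word_ballP; split=> [/orP[/LP/word_ballP[l ln <-]|]|[l]].
- by exists l => //; exact: leqW.
- move=> /allpairsP[[h x] /= [/LP/word_ballP[l ln <-] _ ->]].
  by exists (rcons l x); rewrite ?size_rcons ?spell_rcons.
case/lastP: l => [|l x] ln <-.
  by apply/orP; left; apply/LP/word_ballP; exists [::].
rewrite size_rcons ltnS in ln; apply/orP; right; apply/allpairsP.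
exists (spell l, x); split; rewrite ?mem_enum// ?spell_rcons//.
by apply/LP/word_ballP; exists l.
Qed.

End Letters.

Section Growth.
Import GRing.Theory Num.Theory.
Local Open Scope ring_scope.
Context (G : groupType) (R : realFieldType) (H : seq G -> R).
Hypothesis Hent : translation_entropy H.
Context (r : nat) (s : 'I_r -> G).
Local Notation ball := (word_ball (group_generators s)).
Local Notation rose := (rose_weight H s).

(** Let [W1] be [W] with [g * x] added, [x] being [s i] or its inverse.  The
    petals other than [i] only gain mutual information.  On the petal [i], one of
    the two labels can be enlarged from [W] to [W1] without changing the join of
    both, because [g * x] is already in [W s_i], respectively
    [g] is in [W]; so its mutual information grows by H(W1) - H(W) at least,
    which compensates the entropy gained at the vertex. *)
Lemma rose_weight_grow W g x : g \in W -> rose ((g * letter s x)%g :: W) <= rose W.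
Proof.
move=> gW; set W1 := _ :: W.
have WW1 : {subset W <= W1} by move=> h hW; rewrite inE hW orbT.
suff key : H W1 + mutual H (translate W (s x.1)) W - H W <=
       mutual H (translate W1 (s x.1)) W1.
  rewrite /rose_weight (bigD1 x.1)//= [in leRHS](bigD1 x.1)//=.
  have : \sum_(i | i != x.1) mutual H (translate W (s i)) W <=
         \sum_(i | i != x.1) mutual H (translate W1 (s i)) W1.
    by apply: ler_sum => i _; apply: mutual_mono => //; apply: translate_sub.
  move: key; lra.
have [lE|lE] : letter s x = (s x.1)^-1%g \/ letter s x = s x.1.
  by rewrite /letter; case: x.2; [left|right].
  have -> : H W1 + mutual H (translate W (s x.1)) W - H W =
            mutual H (translate W1 (s x.1)) W.
    rewrite /mutual !(tent_translate Hent).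
    rewrite (tent_eq Hent (_ : translate W1 (s x.1) ++ W =i translate W (s x.1) ++ W)).
      lra.
    by move=> h; rewrite !mem_cat /= inE lE mulgVK; case: eqP => // ->; rewrite gW !orbT.
  exact: mutual_mono.
have -> : H W1 + mutual H (translate W (s x.1)) W - H W =
          mutual H (translate W (s x.1)) W1.
  rewrite /mutual !(tent_translate Hent).
  rewrite (tent_eq Hent (_ : translate W (s x.1) ++ W1 =i translate W (s x.1) ++ W)).
    lra.
  move=> h; rewrite !mem_cat inE lE; case: eqP => // ->.
  by rewrite (map_f (fun a => (a * s x.1)%g) gW).
by apply: mutual_mono => //; apply: translate_sub.
Qed.

(** The bound on the new elements keeps the grown label inside the ball of
    radius [n] that it is meant to fill. *)
Definition grows n W W' : Prop :=
  [/\ {subset W <= W'}, forall g, g \in W' -> g \in W \/ ball n g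
    & rose W' <= rose W].

Lemma grows_refl n W : grows n W W.
Proof. by split=> // g; left. Qed.

Lemma grows_trans n W W' W'' : grows n W W' -> grows n W' W'' -> grows n W W''.
Proof.
move=> [s1 b1 l1] [s2 b2 l2]; split; last exact: le_trans l1.
  by move=> g /s1/s2.
by move=> g /b2[/b1//|]; right.
Qed.

Lemma grows_letter n W g x : g \in W -> ball n (g * letter s x)%g ->
  grows n W ((g * letter s x)%g :: W).
Proof.
move=> gW gx; split; last exact: rose_weight_grow.
  by move=> h hW; rewrite inE hW orbT.
by move=> h; rewrite inE => /orP[/eqP ->|]; [right|left].
Qed.

(** The label is grown backwards along the prefixes of a word spelling one of its
    elements, all of which lie in the ball. *)
Lemma grows_to_one n W l : (size l <= n)%N -> spell s l \in W ->
  exists2 W', grows n W W' & 1%g \in W'.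
Proof.
elim/last_ind: l W => [|l [i b] IH] W.
  by rewrite spell_nil; exists W => //; exact: grows_refl.
rewrite size_rcons spell_rcons => ln lW.
have lE : spell s l = (spell s l * letter s (i, b) * letter s (i, ~~ b))%g.
  by rewrite /letter; case: b {lW} => /=; rewrite ?mulgK ?mulgVK.
have /(grows_letter lW) gr : ball n (spell s l * letter s (i, b) * letter s (i, ~~ b))%g.
  by rewrite -lE; apply/word_ballP; exists l => //; exact: ltnW.
rewrite -lE in gr; have [|W' gr' oW'] := IH (spell s l :: W) (ltnW ln).
  by rewrite inE eqxx.
by exists W' => //; exact: grows_trans gr'.
Qed.

Lemma grows_from_one n W l : (size l <= n)%N -> 1%g \in W ->
  exists2 W', grows n W W' & spell s l \in W'.
Proof.
move=> + oW; elim/last_ind: l => [|l x IH].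
  by rewrite spell_nil; exists W => //; exact: grows_refl.
rewrite size_rcons => ln; have [W' gr lW'] := IH (ltnW ln).
exists ((spell s l * letter s x)%g :: W'); last by rewrite spell_rcons inE eqxx.
apply: (grows_trans gr); apply: grows_letter => //.
by apply/word_ballP; exists (rcons l x); rewrite ?size_rcons ?spell_rcons.
Qed.

(** From a label inside a ball, first reach the identity, then every element of
    the ball along the prefixes of its spelling. *)
Lemma grows_to_ball W : free_group s -> W != [::] ->
  exists n L, (forall g, g \in L <-> ball n g) /\ rose L <= rose W.
Proof.
move=> sfree W0.
have [n Wn] : exists n, forall g, g \in W -> ball n g.
  elim: W {W0} => [|g W [n IH]]; first by exists 0%N.
  have [l lg] := free_group_spelling sfree g.
  exists (maxn n (size l)) => h; rewrite inE => /orP[/eqP ->|/IH].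
    by apply/word_ballP; exists l => //; exact: leq_maxr.
  move/word_ballP => [l' l'n <-]; apply/word_ballP; exists l' => //.
  by rewrite (leq_trans l'n)// leq_maxl.
have [L LP] := word_ball_enum s n.
have [w wW] : exists w, w \in W by case: W W0 {Wn} => // w W _; exists w; rewrite inE eqxx.
have [l ln lw] := (word_ballP s n w).1 (Wn w wW); rewrite -lw in wW.
have [W1 gr1 oW1] := grows_to_one ln wW.
have [W2 gr2 LW2] : exists2 W2, grows n W1 W2 & {subset L <= W2}.
  have : {subset L <= L} by [].
  elim: {1 3}L => [_|g L' IH sub]; first by exists W1 => //; exact: grows_refl.
  have [g' g'L'|W2 gr2 LW2] := IH; first by apply: sub; rewrite inE g'L' orbT.
  have /LP/word_ballP[l' l'n l'g] : g \in L by apply: sub; rewrite inE eqxx.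
  have [|W3 gr3 gW3] := grows_from_one (W := W2) l'n; first by case: gr2 => + _ _; apply.
  exists W3; first exact: grows_trans gr3.
  move=> h; rewrite inE => /orP[/eqP ->|/LW2]; first by rewrite -l'g.
  by case: gr3 => + _ _; apply.
have [_ W2P W2w] := grows_trans gr1 gr2.
exists n, L; split=> //; apply: le_trans W2w.
suff LE : L =i W2.
  rewrite /rose_weight (tent_eq Hent LE) lerD2l lerN2 ler_sum// => i _.
  by apply: mutual_mono => [//||g]; first apply: translate_sub => g; rewrite LE.
by move=> g; apply/idP/idP => [/LW2//|/W2P[/Wn|] /LP].
Qed.

End Growth.

(** * Change of basis through the subdivided rose *)

Section WalkGroup.
Context (G : groupType) (r : nat) (s : 'I_r -> G) (V : finType) (E : {set edge r V}).

Lemma walk_cat a n g b m h c :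
  walk s E a n g b -> walk s E b m h c -> walk s E a (n + m) (g * h)%g c.
Proof.
move=> ab; elim=> [|{}m {}h u i {}c _ IH uc|{}m {}h u i {}c _ IH uc].
- by rewrite addn0 mulg1.
- by rewrite addnS mulgA; apply: walk_fwd IH uc.
- by rewrite addnS mulgA; apply: walk_bwd IH uc.
Qed.

Lemma walk_rev a n g b : walk s E a n g b -> walk s E b n g^-1%g a.
Proof.
elim=> [|{}n {}g u i {}b _ IH ub|{}n {}g u i {}b _ IH ub].
- by rewrite invg1; apply: walk_nil.
- rewrite invgM -[n.+1]/(1 + n)%N; apply: walk_cat IH.
  by rewrite -[_^-1%g]mul1g; apply: walk_bwd ub; apply: walk_nil.
- rewrite invgM invgK -[n.+1]/(1 + n)%N; apply: walk_cat IH.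
  by rewrite -[s i]mul1g; apply: walk_fwd ub; apply: walk_nil.
Qed.

Lemma walk_spell root (t : 'I_r -> G) l :
  (forall i, exists n, walk s E root n (t i) root) ->
  exists n, walk s E root n (spell t l) root.
Proof.
move=> tw; elim/last_ind: l => [|l [i b] [n IH]].
  by exists 0; rewrite spell_nil; apply: walk_nil.
rewrite spell_rcons; have [m tm] := tw i; exists (n + m)%N.
by apply: walk_cat IH _; rewrite /letter; case: b => //=; apply: walk_rev.
Qed.

End WalkGroup.

Section SubdividedRose.
Context (G : groupType) (r : nat) (s : 'I_r -> G).
Context (l : 'I_r -> seq ('I_r * bool)) (l_gt0 : forall j, (0 < size (l j))%N).

(** The vertices of the rose with one petal per word [l j], each petal being
    subdivided into one edge per letter: the base vertex is [None], and
    the petal [j] has one interior vertex between consecutive letters. *)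
Definition stop : finType := option {j : 'I_r & 'I_(size (l j)).-1}.

(** The vertex reached after [k] letters of the petal [j].  The partial
    projection fails for [k] equal to the length of the word, which closes the
    petal at the base vertex. *)
Definition stop_at (j : 'I_r) (k : nat) : stop :=
  if k isn't k'.+1 then None
  else omap (@Tagged _ j (fun j => 'I_(size (l j)).-1)) (insub k').

Arguments stop_at : simpl never.

Lemma stop_at_end j : stop_at j (size (l j)) = None.
Proof.
by rewrite -{1}(prednK (l_gt0 j)) /stop_at insubN// ltnn.
Qed.

Lemma stop_at_mid j (k : 'I_(size (l j)).-1) : stop_at j k.+1 = Some (Tagged _ k).
Proof. by rewrite /stop_at valK. Qed.

Definition segment (p : {j : 'I_r & 'I_(size (l j))}) : edge r stop :=
  let j := tag p in let k := tagged p in let x := tnth (in_tuple (l j)) k in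
  if x.2 then (stop_at j k.+1, x.1, stop_at j k) else (stop_at j k, x.1, stop_at j k.+1).

Definition segments : {set edge r stop} := segment @: {: {j : 'I_r & 'I_(size (l j))}}.

Definition prefix j k : G := spell s (take k (l j)).

Lemma prefixS j (k : 'I_(size (l j))) :
  prefix j k.+1 = (prefix j k * letter s (tnth (in_tuple (l j)) k))%g.
Proof.
set x := tnth _ _; rewrite /prefix (take_nth x)// spell_rcons.
congr (_ * letter s _)%g; exact/esym/tnth_nth.
Qed.

Lemma walk_prefix j k : (k <= size (l j))%N ->
  walk s segments None k (prefix j k) (stop_at j k).
Proof.
elim: k => [_|k IH kl]; first by rewrite /prefix take0 spell_nil; apply: walk_nil.
have w := IH (ltnW kl); rewrite (prefixS (Ordinal kl)) /letter.
have : segment (Tagged _ (Ordinal kl)) \in segments by apply: imset_f.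
rewrite /segment /=; case: (tnth _ _).2 => se; first exact: walk_bwd se.
exact: walk_fwd se.
Qed.

Lemma marked_segments :
  (forall i, exists w, spell (fun j => spell s (l j)) w = s i) ->
  marked s segments [set: stop] None.
Proof.
move=> gen; split.
- by rewrite inE.
- by move=> e _; split; rewrite inE.
- move=> [[j k]|] _; last by exists 0, 1%g; apply: walk_nil.
  exists k.+1, (prefix j k.+1); rewrite -stop_at_mid; apply: walk_prefix.
  exact: leq_trans (ltn_ord k) (leq_pred _).
- move=> i; have [w <-] := gen i; apply: walk_spell => j; exists (size (l j)).
  by have := walk_prefix (leqnn (size (l j))); rewrite stop_at_end /prefix take_size.
Qed.

Import GRing.Theory Num.Theory.
Local Open Scope ring_scope.

Lemma card_stops : (#|[set: stop]| + r = (\sum_j size (l j)).+1)%N.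
Proof.
rewrite cardsT card_option card_tagged sumnE big_map big_enum /=.
have rE : (\sum_(j < r) 1)%N = r by rewrite sum1_card card_ord.
rewrite addSn; congr _.+1; rewrite -[X in (_ + X)%N]rE -big_split/=.
by apply: eq_bigr => j _; rewrite card_ord addn1 prednK.
Qed.

(** A priori two letters could give the same edge, for instance when a word
    backtracks; the lower bound of [card_marked] excludes it. *)
Lemma card_segments :
  (forall i, exists w, spell (fun j => spell s (l j)) w = s i) ->
  free_group s -> 'I_r ->
  [/\ injective segment & (#|segments| < r + #|[set: stop]|)%N].
Proof.
move=> gen sfree i0.
have cE : #|{: {j : 'I_r & 'I_(size (l j))}}| = (\sum_j size (l j))%N.
  rewrite card_tagged sumnE big_map big_enum /=.
  by apply: eq_bigr => j _; rewrite card_ord.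
have le1 := card_marked i0 sfree (marked_segments gen).
rewrite addnC card_stops ltnS -cE in le1; split.
  have /imset_injP : #|segments| == #|{: {j : 'I_r & 'I_(size (l j))}}|.
    by rewrite eqn_leq le1 leq_imset_card.
  by move=> inj p q; apply: inj.
by rewrite addnC card_stops ltnS -cE leq_imset_card.
Qed.

Context (R : realFieldType) (H : seq G -> R) (Hent : translation_entropy H).
Context (W : seq G).

(** Translating by the prefix read so far makes every edge but the last of a
    petal join two copies of [W] in the same position. *)
Definition stop_label (v : stop) : seq G :=
  if v is Some p then translate W (prefix (tag p) (tagged p).+1) else W.

Lemma stop_labelE j k : (k < size (l j))%N ->
  stop_label (stop_at j k) = translate W (prefix j k).
Proof.
case: k => [_|k kl] /=.
  rewrite /prefix take0 spell_nil /translate -[LHS]map_id.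
  by apply: eq_map => a; rewrite mulg1.
have kl' : (k < (size (l j)).-1)%N by rewrite -ltnS prednK.
by rewrite /stop_at insubT.
Qed.

Lemma mutual_self A : mutual H A A = H A.
Proof.
rewrite /mutual (tent_eq Hent (_ : A ++ A =i A)); first by lra.
by move=> g; rewrite mem_cat orbb.
Qed.

Lemma segment_mutual_mid j (k : 'I_(size (l j))) : (k.+1 < size (l j))%N ->
  edge_mutual H s stop_label (segment (Tagged _ k)) = H W.
Proof.
move=> kl; rewrite /edge_mutual /segment /=.
have := prefixS k; rewrite /letter; case: (tnth _ _).2 => pS /=;
  rewrite !stop_labelE// translateM pS ?mulgVK mutual_self;
  exact: tent_translate.
Qed.

Lemma segment_mutual_end j (k : 'I_(size (l j))) : k.+1 = size (l j) ->
  edge_mutual H s stop_label (segment (Tagged _ k)) =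
  mutual H (translate W (spell s (l j))) W.
Proof.
move=> kl; rewrite /edge_mutual /segment /=.
have -> : spell s (l j) = prefix j k.+1 by rewrite kl /prefix take_size.
have := prefixS k; rewrite /letter; case: (tnth _ _).2 => -> /=;
  rewrite [in stop_label (stop_at j k.+1)]kl stop_at_end stop_labelE//=.
  rewrite mutualC// -(mutual_translate Hent _ _ (s (tnth (in_tuple (l j)) k).1)^-1%g).
  rewrite translateM; congr mutual.
  rewrite translateM mulgV /translate -[RHS]map_id.
  by apply: eq_map => a; rewrite mulg1.
by rewrite translateM.
Qed.

Lemma sum_ord_last n (f : 'I_n -> R) a b : (0 < n)%N ->
  (forall k : 'I_n, (k.+1 < n)%N -> f k = a) -> (forall k : 'I_n, k.+1 = n -> f k = b) ->
  \sum_k f k = a *+ n.-1 + b.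
Proof.
case: n f => // n f _ fa fb; rewrite big_ord_recr /= fb//; congr (_ + _).
rewrite -[n in RHS]card_ord -sumr_const; apply: eq_bigr => k _.
by rewrite fa//= ltnS.
Qed.

(** Along a petal each interior vertex adds an entropy H(W) that is cancelled
    by the mutual information of the edge leading to it; the last edge carries
    the mutual information of the original petal. *)
Lemma weight_segments : injective segment ->
  weight H s segments [set: stop] stop_label =
  rose_weight H (fun j => spell s (l j)) W.
Proof.
move=> inj; rewrite /weight /rose_weight /segments big_imset /=; last first.
  by move=> p q _ _; apply: inj.
have -> : \sum_(v in [set: stop]) H (stop_label v) =
    H W + \sum_j H W *+ (size (l j)).-1.
  rewrite (bigD1 None) ?inE//=; congr (_ + _).
  rewrite (reindex_omap Some id) => [|[p|]]//=; last by rewrite inE.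
  rewrite (eq_bigl xpredT) => [|p]; last by rewrite inE eqxx.
  transitivity (\sum_(p : {j : 'I_r & 'I_(size (l j)).-1}) H W).
    by apply: eq_bigr => p _; rewrite (tent_translate Hent).
  rewrite -(@sig_big_dep _ _ _ _ (fun j => 'I_(size (l j)).-1) xpredT (fun _ => xpredT)
    (fun _ _ => H W)) /=.
  by apply: eq_bigr => j _; rewrite sumr_const card_ord.
have -> : \sum_(p in {: {j : 'I_r & 'I_(size (l j))}})
      edge_mutual H s stop_label (segment p) =
    \sum_j (H W *+ (size (l j)).-1 + mutual H (translate W (spell s (l j))) W).
  transitivity (\sum_(p : {j : 'I_r & 'I_(size (l j))})
      edge_mutual H s stop_label (segment (Tagged _ (tagged p)))).
    by rewrite (eq_bigl xpredT) => [|p]; [apply: eq_bigr => -[]|rewrite inE].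
  rewrite -(@sig_big_dep _ _ _ _ (fun j => 'I_(size (l j))) xpredT (fun _ => xpredT)
    (fun j (k : 'I_(size (l j))) =>
      edge_mutual H s stop_label (segment (Tagged _ k)))) /=.
  apply: eq_bigr => j _; apply: sum_ord_last => //.
    exact: segment_mutual_mid.
  exact: segment_mutual_end.
rewrite big_split/=; lra.
Qed.

End SubdividedRose.

Section BasisChange.
Import GRing.Theory Num.Theory.
Local Open Scope ring_scope.
Context (G : groupType) (R : realFieldType) (H : seq G -> R).
Hypothesis Hent : translation_entropy H.
Context (r : nat) (s t : 'I_r -> G).

Lemma rose_weight_basis_change W : (0 < r)%N -> free_group s ->
  (forall i, exists w, spell t w = s i) ->
  exists2 W', {subset W <= W'} & rose_weight H s W' <= rose_weight H t W.
Proof.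
move=> r_gt0 sfree gen; pose i0 := Ordinal r_gt0.
have /choice[l lP] : forall j, exists l, (0 < size l)%N /\ spell s l = t j.
  move=> j; have [l lt] := free_group_spelling sfree (t j).
  (* A trivial backtrack is appended to make the word nonempty. *)
  exists (rcons (rcons l (i0, false)) (i0, true)).
  by rewrite !size_rcons !spell_rcons /letter /= mulgK.
have l_gt0 j : (0 < size (l j))%N by case: (lP j).
have tE : (fun j => spell s (l j)) = t by apply/funext => j; case: (lP j).
have gen' : forall i, exists w, spell (fun j => spell s (l j)) w = s i by rewrite tE.
have [inj lt] := card_segments l_gt0 gen' sfree i0.
have [W' sub le] := fold_to_rose Hent i0 sfree (stop_label s W)
  (marked_segments l_gt0 gen') lt.
by exists W' => //; rewrite -tE -weight_segments.
Qed.

Lemma ball_weight_basis_change W : W != [::] -> (0 < r)%N -> free_group s ->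
  (forall i, exists w, spell t w = s i) ->
  exists n L, (forall g, g \in L <-> word_ball (group_generators s) n g) /\
    rose_weight H s L <= rose_weight H t W.
Proof.
move=> W0 r_gt0 sfree gen.
have [W' sub le] := rose_weight_basis_change W r_gt0 sfree gen.
have W'0 : W' != [::].
  by case: W W0 sub {le} => // w W _ /(_ w); rewrite inE eqxx => /(_ erefl); case: W'.
have [n [L [LP Lle]]] := grows_to_ball Hent sfree W'0.
by exists n, L; split=> //; apply: le_trans le.
Qed.

End BasisChange.

(** * Shannon entropy of finite random variables *)

Section FiniteEntropy.
Import GRing.Theory Num.Theory.
Local Open Scope ring_scope.
Context (R : realType) (Omega : finType) (p : Omega -> R).
Hypotheses (p_ge0 : forall t, 0 <= p t) (p_sum1 : \sum_t p t = 1).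

Definition marginal (B : finType) (f : Omega -> B) (b : B) : R := \sum_(t | f t == b) p t.

Definition marginal_entropy (B : finType) (f : Omega -> B) : R :=
  - \sum_t p t * ln (marginal f (f t)).

Lemma marginal_ge0 (B : finType) (f : Omega -> B) b : 0 <= marginal f b.
Proof. exact: sumr_ge0. Qed.

Lemma le_marginal (B : finType) (f : Omega -> B) t : p t <= marginal f (f t).
Proof. by rewrite /marginal (bigD1 t)//= lerDl sumr_ge0. Qed.

Lemma marginal_entropyE (B : finType) (f : Omega -> B) :
  marginal_entropy f = \sum_b - (marginal f b * ln (marginal f b)).
Proof.
rewrite /marginal_entropy sumrN (partition_big f xpredT)//=; congr (- _).
apply: eq_bigr => b _; rewrite {2}/marginal mulr_suml.
by apply: eq_bigr => t /eqP ->.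
Qed.

Lemma le_marginal_entropy (B C : finType) (g : Omega -> C) (h : C -> B) :
  marginal_entropy (h \o g) <= marginal_entropy g.
Proof.
rewrite lerN2; apply: ler_sum => t _.
have [->|p0] := eqVneq (p t) 0; first by rewrite !mul0r.
have pt : 0 < p t by rewrite lt_def p0 p_ge0.
have m0 (D : finType) (k : Omega -> D) : 0 < marginal k (k t).
  exact: lt_le_trans (le_marginal k t).
rewrite ler_wpM2l// ler_ln ?posrE ?m0// ?(m0 _ (h \o g))//.
rewrite /marginal big_mkcond [leRHS]big_mkcond; apply: ler_sum => u _ /=.
by case: eqP => [->|_]; rewrite ?eqxx//; case: ifP.
Qed.

Lemma marginal_fst (B C : finType) (f : Omega -> B) (k : Omega -> C) c :
  \sum_b marginal (fun t => (f t, k t)) (b, c) = marginal k c.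
Proof.
rewrite [RHS](partition_big f xpredT)//=; apply: eq_bigr => b _.
by apply: eq_bigl => t; rewrite xpair_eqE andbC.
Qed.

Lemma marginal_sum (B : finType) (f : Omega -> B) : \sum_b marginal f b = 1.
Proof. by rewrite -p_sum1 [RHS](partition_big f xpredT). Qed.

(** Conditional mutual information is nonnegative: the logarithm is bounded by
    ln q <= q - 1, where q is the ratio between the distribution that makes [f]
    and [g] independent given [k] and the true one, and the expectation of q is
    at most one. *)
Lemma marginal_entropy_submodular (B C D : finType)
    (f : Omega -> B) (g : Omega -> C) (k : Omega -> D) :
  marginal_entropy (fun t => (f t, g t, k t)) + marginal_entropy k <=
  marginal_entropy (fun t => (f t, k t)) + marginal_entropy (fun t => (g t, k t)).
Proof.
pose a := marginal (fun t => (f t, g t, k t)); pose c := marginal k.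
pose u := marginal (fun t => (f t, k t)); pose v := marginal (fun t => (g t, k t)).
pose q (z : B * C * D) := u (z.1.1, z.2) * v (z.1.2, z.2) / (a z * c z.2).
(* The expectation of q counts only the values taken with positive
   probability, hence the inequality. *)
have sumq : \sum_t p t * q (f t, g t, k t) <= 1.
  rewrite (partition_big (fun t => (f t, g t, k t)) xpredT)//=.
  have -> : 1 = \sum_z u (z.1.1, z.2) * v (z.1.2, z.2) / c z.2.
    rewrite -(marginal_sum k) -(pair_bigA _ (fun y z => u (y.1, z) * v (y.2, z) / c z)) /=.
    rewrite exchange_big /=; apply: eq_bigr => z _.
    rewrite -(pair_bigA _ (fun x y => u (x, z) * v (y, z) / c z)) /=.
    under eq_bigr do rewrite -mulr_suml -mulr_sumr.
    rewrite -mulr_suml -mulr_suml marginal_fst marginal_fst -/c.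
    by have [->|c0] := eqVneq (c z) 0; rewrite ?mul0r// mulfK.
  apply: ler_sum => z _.
  have -> : \sum_(t | (f t, g t, k t) == z) p t * q (f t, g t, k t) = a z * q z.
    by rewrite /a /marginal mulr_suml; apply: eq_bigr => t /eqP ->.
  rewrite /q invfM; have [->|a0] := eqVneq (a z) 0; last first.
    by rewrite mulrCA mulVKf.
  by rewrite mul0r mulr_ge0 ?mulr_ge0 ?invr_ge0 ?marginal_ge0.
rewrite /marginal_entropy -!opprD lerN2 -!big_split /= -subr_ge0 -sumrB.
suff le_t t : p t - p t * q (f t, g t, k t) <=
    p t * ln (a (f t, g t, k t)) + p t * ln (c (k t)) -
    (p t * ln (u (f t, k t)) + p t * ln (v (g t, k t))).
  apply: le_trans (ler_sum _ (fun t _ => le_t t)).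
  by rewrite sumrB p_sum1 subr_ge0.
have [->|p0] := eqVneq (p t) 0; first by rewrite !mul0r !subr0 addr0.
have pt : 0 < p t by rewrite lt_def p0 p_ge0.
have m0 (E : finType) (h : Omega -> E) : 0 < marginal h (h t).
  exact: lt_le_trans (le_marginal h t).
have a0 : 0 < a (f t, g t, k t) := m0 _ (fun t => (f t, g t, k t)).
have u0 : 0 < u (f t, k t) := m0 _ (fun t => (f t, k t)).
have v0 : 0 < v (g t, k t) := m0 _ (fun t => (g t, k t)).
have c0 : 0 < c (k t) := m0 _ k.
rewrite -!mulrDr -mulrBr -{1}[p t]mulr1 -mulrBr ler_wpM2l//.
have q0 : 0 < q (f t, g t, k t) by rewrite /q divr_gt0 ?mulr_gt0.
have : ln (q (f t, g t, k t)) <= q (f t, g t, k t) - 1.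
  by rewrite -[X in ln X](subrKC 1) le_ln1Dx// ltrBrDl subrr.
rewrite {1}/q /= ln_div ?posrE ?mulr_gt0// !lnM ?posrE//; lra.
Qed.

End FiniteEntropy.

(** * Entropy of observables and of itineraries *)

Section ObservableEntropy.
Import GRing.Theory Num.Theory.
Local Open Scope ring_scope.
Local Open Scope classical_set_scope.
Context (R : realType) (d : measure_display) (X : measurableType d).
Context (mu : probability X R).

Definition law (B : finType) (psi : X -> B) (b : B) : R := fine (mu (psi @^-1` [set b])).

Definition entropy (B : finType) (psi : X -> B) : R :=
  \sum_b - (law psi b * ln (law psi b)).

Lemma fsbig_finType (B : finType) (S : set B) (F : B -> \bar R) :
  (\sum_(b \in S) F b = \sum_(b | b \in S) F b)%E.
Proof.
rewrite (fsbigE (enum [pred b | b \in S])) ?enum_uniq//.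
- by rewrite big_enum_cond; apply: eq_bigl => b; rewrite inE andbb.
- by move=> b; rewrite /= mem_enum; exact: (@set_mem _ S b).
- by move=> b Sb; rewrite mem_enum => /negP[]; exact: (@mem_set _ S b).
Qed.

Lemma preimage_fibers (B : finType) (psi : X -> B) (S : set B) :
  psi @^-1` S = \bigcup_(b in S) (psi @^-1` [set b]).
Proof. by apply/seteqP; split=> [x Sx|x [b Sb /= ->]//]; exists (psi x). Qed.

Lemma observable_fibers (B : finType) (psi : X -> B) :
  (forall b, measurable (psi @^-1` [set b])) -> observable psi.
Proof.
move=> mpsi S; rewrite preimage_fibers.
by apply: fin_bigcup_measurable => // b _; exact: mpsi.
Qed.

Lemma law_ge0 (B : finType) (psi : X -> B) b : 0 <= law psi b.
Proof. by apply: fine_ge0. Qed.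

Lemma measure_preimage (B : finType) (psi : X -> B) (S : {pred B}) :
  observable psi -> fine (mu (psi @^-1` [set` S])) = \sum_(b | b \in S) law psi b.
Proof.
move=> mpsi; rewrite preimage_fibers measure_fin_bigcup; first last.
- by move=> b _; exact: mpsi.
- by move=> b c _ _ [x [/= <- <-]].
- exact: finite_finset.
rewrite fsbig_finType -sum_fine; last by move=> b _; apply/fin_num_measure/mpsi.
by apply: eq_bigl => b; apply/idP/idP; rewrite inE.
Qed.

Lemma law_le1 (B : finType) (psi : X -> B) b : observable psi -> law psi b <= 1.
Proof.
by move=> mpsi; rewrite -lee_fin fineK ?probability_le1 ?fin_num_measure//; exact: mpsi.
Qed.

Lemma law_sum1 (B : finType) (psi : X -> B) : observable psi -> \sum_b law psi b = 1.
Proof.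
move=> mpsi; rewrite -(measure_preimage predT mpsi).
rewrite (_ : _ @^-1` _ = setT) ?probability_setT//.
by apply/seteqP; split.
Qed.

Lemma law_comp (Omega B : finType) (theta : X -> Omega) (f : Omega -> B) b :
  observable theta -> law (f \o theta) b = marginal (law theta) f b.
Proof.
move=> mtheta; have := measure_preimage [pred t | f t == b] mtheta.
rewrite /marginal (eq_bigl (fun t => f t == b))// => <-.
by congr (fine (mu _)); apply/seteqP; split=> x /= /eqP.
Qed.

Lemma entropy_comp (Omega B : finType) (theta : X -> Omega) (f : Omega -> B) :
  observable theta -> entropy (f \o theta) = marginal_entropy (law theta) f.
Proof.
move=> mtheta; rewrite marginal_entropyE.
by apply: eq_bigr => b _; rewrite law_comp.
Qed.

Lemma probability_point : exists x : X, True.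
Proof.
apply: contrapT => nX; suff : mu setT = 0%E.
  by rewrite probability_setT => /eqP; rewrite onee_eq0.
rewrite (_ : setT = set0) ?measure0//.
by apply/seteqP; split=> // x _; apply: nX; exists x.
Qed.

(** Entropies are compared through this relation between observables, which
    avoids naming the function through which one factors. *)
Definition determines (B C : Type) (theta : X -> C) (psi : X -> B) : Prop :=
  forall x y, theta x = theta y -> psi x = psi y.

Lemma determines_factor (B C : Type) (theta : X -> C) (psi : X -> B) :
  determines theta psi -> exists f : C -> B, psi = f \o theta.
Proof.
move=> det; have [x0 _] := probability_point.
have /choice[g gP] : forall c, exists x, (exists y, theta y = c) -> theta x = c.
  by move=> c; have [[y yc]|nc] := pselect (exists y, theta y = c); [exists y|exists x0].
exists (psi \o g); apply/funext => x /=; apply/det/esym/gP.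
by exists x.
Qed.

Lemma le_entropy (B C : finType) (theta : X -> C) (psi : X -> B) :
  observable theta -> determines theta psi -> entropy psi <= entropy theta.
Proof.
move=> mtheta /determines_factor[f ->].
rewrite -[leRHS]/(entropy (idfun \o theta)) !entropy_comp//.
exact: (le_marginal_entropy (law_ge0 theta) idfun f).
Qed.

Lemma eq_entropy (B C : finType) (theta : X -> C) (psi : X -> B) :
  observable theta -> observable psi ->
  (forall x y, theta x = theta y <-> psi x = psi y) -> entropy psi = entropy theta.
Proof.
by move=> mt mp tp; apply/le_anti/andP; split; apply: le_entropy => // x y /tp.
Qed.

Lemma observable_pair (B C : finType) (f : X -> B) (g : X -> C) :
  observable f -> observable g -> observable (fun x => (f x, g x)).
Proof.
move=> mf mg; apply: observable_fibers => -[b c].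
rewrite (_ : _ @^-1` _ = (f @^-1` [set b]) `&` (g @^-1` [set c])).
  exact: measurableI.
by apply/seteqP; split=> x /= [-> ->].
Qed.

Lemma entropy_submodular (B C D : finType) (f : X -> B) (g : X -> C) (k : X -> D) :
  observable f -> observable g -> observable k ->
  entropy (fun x => (f x, g x, k x)) + entropy k <=
  entropy (fun x => (f x, k x)) + entropy (fun x => (g x, k x)).
Proof.
move=> mf mg mk; pose theta x := (f x, g x, k x).
have mt : observable theta by apply: observable_pair => //; apply: observable_pair.
have := marginal_entropy_submodular (law_ge0 theta) (law_sum1 mt)
  (fun t => t.1.1) (fun t => t.1.2) (fun t => t.2).
by rewrite -!entropy_comp.
Qed.

(** The nonempty members of [alpha] are the fibers of [psi]; whether the empty
    set belongs to [alpha] is left open, since the join of two partitions may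
    contain it. *)
Definition cells (B : Type) (psi : X -> B) (alpha : set (set X)) : Prop :=
  forall P, P !=set0 -> (alpha P <-> exists x, P = [set y | psi y = psi x]).

Lemma partition_entropyE (B : finType) (psi : X -> B) alpha : observable psi ->
  cells psi alpha ->
  partition_entropy mu alpha = (entropy psi)%:E.
Proof.
move=> mpsi calpha; pose g b := psi @^-1` [set b].
pose eta P := (- (fine (mu P) * ln (fine (mu P))))%:E.
pose D := [set b | g b !=set0].
have eta0 : eta set0 = 0%E by rewrite /eta measure0 mul0r oppr0.
have -> : partition_entropy mu alpha = (\esum_(P in g @` D) eta P)%E.
  rewrite /partition_entropy esum_mkcond [RHS]esum_mkcond; apply: eq_esum => P _.
  have [->|/set0P P0] := eqVneq P set0; first by rewrite -/(eta _) eta0 !if_same.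
  congr (if _ then _ else _); apply/idP/idP; rewrite !inE => aP.
    have [x PE] := (calpha P P0).1 aP; exists (psi x); first by exists x.
    by rewrite PE.
  case: aP => b [x /= xb] <-; apply/calpha; first by exists x.
  by exists x; rewrite /g -xb.
rewrite esum_image; last first.
  by move=> b c; rewrite !inE => -[x /= xb] _ gbc; have : g c x; [rewrite -gbc|rewrite /g /= -xb].
rewrite esum_fset; [|exact: finite_finset|]; last first.
  move=> b _; rewrite lee_fin oppr_ge0 -/(law psi b) mulr_ge0_le0 ?law_ge0//.
  by rewrite ln_le0// law_le1.
rewrite fsbig_finType /entropy -sumEFin big_mkcond /=; apply: eq_bigr => b _.
case: ifPn => //; rewrite notin_setE /D /= => /set0P/negP/negPn/eqP gb0.
by rewrite -/(eta (g b)) gb0 eta0.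
Qed.

Lemma eq_cells (B C : Type) (psi : X -> B) (psi' : X -> C) alpha :
  (forall x y, psi x = psi y <-> psi' x = psi' y) ->
  cells psi alpha -> cells psi' alpha.
Proof.
move=> pp' cpsi P P0; rewrite (cpsi P P0); split=> -[x ->]; exists x;
  by apply/seteqP; split=> y /= /pp'.
Qed.

Lemma cells_observable (B : finType) (psi : X -> B) :
  cells psi (observable_partition psi).
Proof.
move=> P [z Pz]; split=> [[b _ PE]|[x ->]]; last by exists (psi x).
by exists z; move: Pz; rewrite -PE /= => ->.
Qed.

Lemma cells_preimage (B : Type) (psi : X -> B) alpha (t : X -> X) :
  cells psi alpha -> cells (psi \o t) (partition_preimage t alpha).
Proof.
move=> cpsi P [z Pz]; split=> [[Q aQ PE]|[x ->]].
  have Qz : Q (t z) by move: Pz; rewrite -PE.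
  have [x QE] := (cpsi Q (ex_intro _ _ Qz)).1 aQ.
  by exists z; move: Qz; rewrite -PE QE /= => ->.
exists [set y | psi y = psi (t x)] => //; apply/cpsi; first by exists (t x).
by exists (t x).
Qed.

Lemma cells_join (B C : Type) (psi : X -> B) (chi : X -> C) alpha beta :
  cells psi alpha -> cells chi beta ->
  cells (fun x => (psi x, chi x)) (partition_join alpha beta).
Proof.
move=> cpsi cchi P [z Pz]; split=> [[Q aQ [S bS PE]]|[x ->]].
  have [Qz Sz] : Q z /\ S z by move: Pz; rewrite -PE.
  have [x QE] := (cpsi Q (ex_intro _ _ Qz)).1 aQ.
  have [y SE] := (cchi S (ex_intro _ _ Sz)).1 bS.
  exists z; rewrite -PE QE SE; move: Qz Sz; rewrite QE SE /= => -> ->.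
  by apply/seteqP; split=> w /= [-> ->].
exists [set y | psi y = psi x]; first by apply/cpsi; [exists x|exists x].
exists [set y | chi y = chi x]; first by apply/cchi; [exists x|exists x].
by apply/seteqP; split=> w /= [-> ->].
Qed.

(** Two points lie in the same cell of the join exactly when they lie in the
    same cell of every member of the family. *)
Lemma cells_bigjoin (I B C : Type) (S : set I) (psi : I -> X -> B) (chi : X -> C) beta :
  (forall i, cells (psi i) (beta i)) ->
  (forall x y, chi x = chi y <-> (forall i, S i -> psi i x = psi i y)) ->
  cells chi (partition_bigjoin S beta).
Proof.
move=> cpsi chiE P [z Pz]; split=> [[Q bQ PE]|[x ->]].
  exists z; rewrite PE; apply/seteqP; split=> w /= Pw.
    apply/chiE => i Si.
    have [x QE] := (cpsi i (Q i) (ex_intro _ w (Pw i Si))).1 (bQ i Si).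
    have : Q i z by move: Pz; rewrite PE; apply.
    by have := Pw i Si; rewrite QE /= => -> ->.
  move=> i Si; have Qz : Q i z by move: Pz; rewrite PE; apply.
  have [x QE] := (cpsi i (Q i) (ex_intro _ z Qz)).1 (bQ i Si).
  by move: Qz; rewrite QE /= => <-; apply: (chiE w z).1 Pw i Si.
exists (fun i => [set y | psi i y = psi i x]).
  by move=> i _; apply/cpsi; exists x.
by apply/seteqP; split=> w /= => [/chiE|Pw]; [|apply/chiE].
Qed.

Lemma entropy_preimage (B : finType) (psi : X -> B) (t : X -> X) :
  observable psi -> (forall A : set X, measurable A -> mu (t @^-1` A) = mu A) ->
  entropy (psi \o t) = entropy psi.
Proof.
move=> mpsi tmu; apply: eq_bigr => b _.
by rewrite /law comp_preimage tmu//; apply: mpsi.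
Qed.

End ObservableEntropy.

Section ActionEntropy.
Import GRing.Theory Num.Theory.
Local Open Scope ring_scope.
Local Open Scope classical_set_scope.
Context (R : realType) (d : measure_display) (X : measurableType d).
Context (mu : probability X R) (A : finType) (phi : X -> A).
Context (G : groupType) (T : G -> X -> X).
Hypotheses (mphi : observable phi) (Tact : measure_preserving_action mu T).

Definition itinerary (W : seq G) (x : X) : (size W).-tuple A :=
  map_tuple (fun g => phi (T g x)) (in_tuple W).

Lemma itineraryP W x y : itinerary W x = itinerary W y <->
  forall g, g \in W -> phi (T g x) = phi (T g y).
Proof.
split=> [/(congr1 val)/eq_in_map//|xy]; apply/val_inj/eq_in_map; exact: xy.
Qed.

Lemma observable_itinerary W : observable (itinerary W).
Proof.
have [_ _ mT _] := Tact.
apply: observable_fibers => t.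
rewrite (_ : _ @^-1` _ = \bigcap_(i in [set: 'I_(size W)])
    (T (tnth (in_tuple W) i) @^-1` (phi @^-1` [set tnth t i]))).
  apply: fin_bigcap_measurable => // i _.
  rewrite -[X in measurable X]setTI; apply: mT => //; exact: mphi.
apply/seteqP; split=> [x /= <- i _ /=|x xt]; first by rewrite tnth_map.
by apply/eq_from_tnth => i; rewrite tnth_map; apply: xt.
Qed.

Definition itinerary_entropy (W : seq G) : R := entropy mu (itinerary W).

(** The itinerary over [W g] is the itinerary over [W] started at [T g x], whose
    law is the same because [T g] preserves the measure; the other two properties
    hold because itineraries over two lists determine the one over their
    concatenation, and conversely. *)
Lemma itinerary_translation_entropy : translation_entropy itinerary_entropy.
Proof.
have [_ TM _ Tmu] := Tact; split=> [U W UW|U W Z|W g].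
- apply: le_entropy; first exact: observable_itinerary.
  by move=> x y /itineraryP xy; apply/itineraryP => g /UW; apply: xy.
- have pair U' W' : itinerary_entropy (U' ++ W') =
      entropy mu (fun x => (itinerary U' x, itinerary W' x)).
    apply: eq_entropy.
    + by apply: observable_pair; apply: observable_itinerary.
    + exact: observable_itinerary.
    move=> x y; split=> [/pair_equal_spec[/itineraryP xU /itineraryP xW]|/itineraryP xUW].
      by apply/itineraryP => g; rewrite mem_cat => /orP[/xU|/xW].
    by congr pair; apply/itineraryP => g gU; apply: xUW; rewrite mem_cat gU ?orbT.
  have -> : itinerary_entropy (U ++ W ++ Z) =
      entropy mu (fun x => (itinerary U x, itinerary W x, itinerary Z x)).
    apply: eq_entropy.
    + by do 2?apply: observable_pair; apply: observable_itinerary.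
    + exact: observable_itinerary.
    move=> x y; split=> [/pair_equal_spec[/pair_equal_spec[]]|/itineraryP xUW].
      move=> /itineraryP xU /itineraryP xW /itineraryP xZ.
      by apply/itineraryP => g; rewrite !mem_cat => /or3P[/xU|/xW|/xZ].
    by congr (_, _, _); apply/itineraryP => g gU; apply: xUW; rewrite !mem_cat gU ?orbT.
  rewrite !pair; apply: entropy_submodular; exact: observable_itinerary.
- rewrite -[RHS](entropy_preimage (@observable_itinerary W) (Tmu g)).
  apply: eq_entropy; last 1 first.
  + move=> x y; split=> [/= /itineraryP xy|/itineraryP xy].
      apply/itineraryP => _ /mapP[a aW ->]; rewrite !TM; exact: xy.
    apply/itineraryP => a aW; have := xy (a * g)%g; rewrite !TM; apply.
    exact: (map_f (fun a => (a * g)%g) aW).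
  + apply: observable_fibers => t; rewrite comp_preimage.
    have [_ _ mT _] := Tact; rewrite -[X in measurable X]setTI; apply: mT => //.
    exact: observable_itinerary.
  + exact: observable_itinerary.
Qed.

(** Stated for a map [K] of the group, so that it covers at once the action
    ([K] the identity) and its twist, which from the point of view of the
    original action uses another basis and the images of the balls. *)
Lemma F_functional_rose (r : nat) (s : 'I_r -> G) (K : G -> G) (S : set G) (L : seq G) :
  (forall g, g \in L <-> S g) ->
  F_functional mu s (twisted_action K T)
    (partition_bigjoin S (fun g =>
       partition_preimage (twisted_action K T g) (observable_partition phi))) =
  (rose_weight itinerary_entropy (K \o s) (map K L))%:E.
Proof.
move=> LS; set beta := partition_bigjoin _ _.
have [_ TM _ _] := Tact.
have cbeta : cells (itinerary (map K L)) beta.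
  apply: (cells_bigjoin (psi := fun g x => phi (T (K g) x))).
    by move=> g; apply: cells_preimage; apply: cells_observable.
  move=> x y; split=> [/itineraryP xy g /LS gL|xy].
    by apply: xy; apply: map_f.
  by apply/itineraryP => _ /mapP[g /LS gS ->]; apply: xy.
rewrite /F_functional (partition_entropyE mu (@observable_itinerary _) cbeta).
pose LKs i := translate (map K L) (K (s i)) ++ map K L.
rewrite (eq_bigr (fun i => (itinerary_entropy (LKs i))%:E)) => [|i _]; last first.
  apply: partition_entropyE; first exact: observable_itinerary.
  apply: eq_cells (cells_join cbeta (cells_preimage _ cbeta)) => x y.
  split=> [/pair_equal_spec[/itineraryP xy /itineraryP xy']|/itineraryP xy].
    apply/itineraryP => g; rewrite mem_cat => /orP[/mapP[a aL ->]|/xy//].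
    by rewrite !TM; apply: xy'.
  congr pair; apply/itineraryP => a aL; first by apply: xy; rewrite mem_cat aL orbT.
  have := xy (a * K (s i))%g; rewrite !TM; apply; rewrite mem_cat; apply/orP; left.
  exact: (map_f (fun a => (a * K (s i))%g) aL).
rewrite sumEFin -EFinM -EFinD; congr _%:E.
have Hent := itinerary_translation_entropy.
rewrite /rose_weight [in RHS](eq_bigr (fun i => itinerary_entropy (map K L) *+ 2 -
  itinerary_entropy (LKs i))) => [|i _]; last first.
  by rewrite /mutual (tent_translate Hent) mulr2n.
rewrite sumrB sumr_const card_ord -mulrnA -[_ *+ (2 * r)]mulr_natr natrM.
rewrite -/(itinerary_entropy _); lra.
Qed.

End ActionEntropy.

(** * Invariance under automorphisms *)

Section GroupAutomorphism.
Import GRing.Theory Num.Theory.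
Context (R : realType) (d : measure_display) (X : measurableType d).
Context (mu : probability X R) (r : nat) (A : finType) (phi : X -> A).
Context (G : groupType) (s : 'I_r -> G).
Hypotheses (r_gt0 : (0 < r)%N) (mphi : observable phi) (sfree : free_group s).

(** The weight of every ball partition of the twisted action is the weight of a
    rose for the basis [omega \o s], and some ball of [s] does not weigh more. *)
Lemma f_observable_twist_ge (T : G -> X -> X) (omega : {multiplicative G -> G}) :
  measure_preserving_action mu T -> bijective omega ->
  (f_observable mu s (group_generators s) T phi <=
   f_observable mu s (group_generators s) (twisted_action omega T) phi)%E.
Proof.
move=> Tact [omega' oK o'K].
have omega1 : omega 1%g = 1%g by apply: (mulgI (omega 1%g)); rewrite -gmulfM !mulg1.
have omegaV g : omega g^-1%g = (omega g)^-1%g.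
  by apply: (mulgI (omega g)); rewrite -gmulfM !mulgV.
have gen i : exists w, spell (omega \o s) w = s i.
  have [w ws] := free_group_spelling sfree (omega' (s i)); exists w.
  rewrite -[RHS]o'K -ws; elim/last_ind: w {ws} => [|w [j b] IH].
    by rewrite !spell_nil omega1.
  by rewrite !spell_rcons gmulfM IH /letter; case: b; rewrite //= omegaV.
apply/ereal_infP => _ [n _ <-].
have [L LP] := word_ball_enum s n.
rewrite (F_functional_rose mphi Tact s omega LP).
have [|m [M [MP Mle]]] := ball_weight_basis_change
  (itinerary_translation_entropy mphi Tact) (W := map omega L) _ r_gt0 sfree gen.
  have /LP : word_ball (group_generators s) n 1%g.
    by exists [::]; split; rewrite ?big_nil.
  by case: L {LP}.
apply: (@le_trans _ _ (rose_weight (itinerary_entropy mu phi T) s M)%:E); last first.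
  by rewrite lee_fin.
apply: ereal_inf_lbound; exists m => //.
by rewrite -[M in RHS]map_id -(F_functional_rose mphi Tact s idfun MP).
Qed.

Lemma twisted_measure_preserving_action (T : G -> X -> X)
    (omega : {multiplicative G -> G}) :
  measure_preserving_action mu T -> measure_preserving_action mu (twisted_action omega T).
Proof.
move=> [T1 TM mT Tmu]; split; rewrite /twisted_action.
- rewrite (_ : omega 1%g = 1%g) ?T1//.
  by apply: (mulgI (omega 1%g)); rewrite -gmulfM !mulg1.
- by move=> g h; rewrite gmulfM TM.
- by move=> g; exact: mT.
- by move=> g; exact: Tmu.
Qed.

Lemma f_observable_free_group (T : G -> X -> X) (omega : {multiplicative G -> G}) :
  measure_preserving_action mu T -> bijective omega ->
  f_observable mu s (group_generators s) T phi =
  f_observable mu s (group_generators s) (twisted_action omega T) phi.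
Proof.
move=> Tact obij; apply/le_anti/andP; split; first exact: f_observable_twist_ge.
have [omega' oK o'K] := obij.
pose oinv : {multiplicative G -> G} := HB.pack omega'
  (isMultiplicative.Build _ _ omega' (can2_gmulfM oK o'K)).
have {2}-> : T = twisted_action oinv (twisted_action omega T).
  by apply/funext => g; rewrite /twisted_action /= o'K.
apply: f_observable_twist_ge; first exact: twisted_measure_preserving_action.
by exists omega.
Qed.

End GroupAutomorphism.

Theorem theorem1p5 (R : realType) (d : measure_display) (X : measurableType d)
    (mu : probability X R) (hX : standard_borel R X)
    (r : nat) (hr : (1 <= r)%N) (A : finType) (phi : X -> A)
    (hphi : observable phi) :
  (forall (G : groupType) (s : 'I_r -> G) (T : G -> X -> X)
      (omega : {multiplicative G -> G}),
     free_group s -> measure_preserving_action mu T -> bijective omega ->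
     f_observable mu s (group_generators s) T phi =
     f_observable mu s (group_generators s) (twisted_action omega T) phi) /\
  (forall (G : monoidType) (s : 'I_r -> G) (T : G -> X -> X)
      (omega : UMagmaMorphism.type G G),
     free_semigroup s -> measure_preserving_action mu T -> bijective omega ->
     f_observable mu s (semigroup_generators s) T phi =
     f_observable mu s (semigroup_generators s) (twisted_action omega T) phi).
Proof.
split=> [G s T omega sfree Tact obij|G s T omega sfree _ obij].
  exact: f_observable_free_group.
exact: f_observable_free_semigroup.
Qed.
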